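(* Let $(!,\epsilon,u,\Delta,m,\partial)$ be a differential modality on an additive symmetric monoidal category $(\mathsf{C},\otimes,I)$. Suppose that for all object $A$ and $n \in \mathbb{N}$, \begin{itemize} \item[1.] $s_n\colon !A \rightarrow !_{\le n}A$ is a cokernel of $\partial^{n+1}\colon !A \otimes A^{\otimes(n+1)} \rightarrow !A$, \item[2.] $s_n \otimes 1_A\colon !A \otimes A \rightarrow !_{\le n}A \otimes A$ is a cokernel of $\partial^{n+1} \otimes 1_A\colon !A \otimes A^{\otimes (n+2)} \rightarrow !A \otimes A$. \end{itemize} Then, there exists a unique $\mathbb{N}$-graded differential modality $(!_{\le n},\epsilon^\le,u^\le,\Delta^\le_{n,p},m^\le _{n,p},\partial^\le_n)$ on $(\mathsf{C},\otimes,I)$ such that: \begin{itemize} \item[1.] the endofunctor $!_{\le n}\colon\mathsf{C} \rightarrow \mathsf{C}$ applied to any object $A$ gives $!_{\le n}A$, \item[2.] $(s_n)_{n \in \mathbb{N}}$ is a $(0\colon\mathbb{N} \rightarrow 0)$-graded morphism of graded differential modalities. \end{itemize} Moreover, there exists a unique family of morphisms $t_{n,p}\colon !_{\le n}A \rightarrow !_{\le p}A$ defined for all $(n,p) \in \mathbb{N}^2$ with $n \ge p$ and $A \in \mathsf{C}$ such that: \begin{itemize} \item[1.] $(!_{\le n},\epsilon^\le,u^\le,\Delta^\le_{n,p},m^\le _{n,p},\partial^\le_n,t_{n,p})$ is an $\mathbb{N}$-filtered differential modality, \item[2.] $(s_n)_{n \in \mathbb{N}}$ is a $(0\colon\mathbb{N}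 \rightarrow 0)$-filtered morphism of $\mathbb{N}$-filtered differential modalities. \end{itemize}
   Context: Composition is written diagrammatically: $f;g = g\circ f$. An additive symmetric monoidal category is a symmetric monoidal category (treated as strict) whose homsets are commutative monoids with composition and $\otimes$ additive in each argument (preserving $0$ and $+$); $\gamma$ denotes the symmetry. A cokernel of $f\colon A\to B$ is a coequalizer of $f$ and $0$. For a rig $R$, an $R$-graded differential modality consists of endofunctors $!_r$ ($r\in R$), natural transformations $m_{r,s}\colon !_{rs}A\to !_r!_sA$, $u\colon !_1A\to A$, $\Delta_{r,s}\colon !_{r+s}A\to !_rA\otimes !_sA$, $\epsilon\colon !_0A\to I$, $\partial_r\colon !_rA\otimes A\to !_{r+1}A$ such that: $(!,m,u)$ is an $R$-graded comonad ($m_{np,q};m_{n,p}=m_{n,pq};!_n m_{p,q}$ and $m_{r,1};!_r u = 1 = m_{1,r};u$); $(!A,\Delta,\epsilon)$ is a cocommutative $R$-graded comonoid ($\Delta_{r+s,t};\Delta_{r,s}\otimes 1=\Delta_{r,s+t};1\otimes\Delta_{s,t}$, $\Delta_{0,0};1\otimes\epsilon=1$, $\Delta_{r,s};\gamma=\Delta_{s,r}$); and $m_{r+s,t};\Delta_{r,s}=\Delta_{rt,st};m_{r,t}\otimes m_{s,t}$; $m_{0,r};\epsilon=\epsilon$; $\partial_0;u=\epsilon\otimes 1$; $\partial_{r+s+1};\Delta_{r+1,s+1}=\Delta_{r+1,s}\otimes 1;1\otimes\partial_s+\Delta_{r,s+1}\otimes 1;1\otimes\gamma;\partial_r\otimes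 1$; $\partial_{rs+r+s};m_{s+1,t+1}=\Delta_{st+s,t}\otimes 1;m_{s,t+1}\otimes\partial_t;\partial_s$; $1\otimes\gamma;\partial_r\otimes 1;\partial_{r+1}=\partial_r\otimes 1;\partial_{r+1}$. A differential modality is a $0$-graded one for the trivial rig $0$ (indices dropped: $!$, $m\colon !A\to !!A$, $u$, $\Delta$, $\epsilon$, $\partial\colon !A\otimes A\to !A$). For a differential modality, $\partial^0:=1_{!A}$ and $\partial^{n+1}:=\partial^n\otimes 1_A;\partial\colon !A\otimes A^{\otimes(n+1)}\to !A$. For natural transformations $\alpha\colon F\Rightarrow G$, $\beta\colon H\Rightarrow J$, the horizontal composite is $(\alpha\bullet\beta)_A := F(\beta_A);\alpha_{J(A)}$. For an ordered rig $(R,\le)$, an $R$-filtered differential modality is an $R$-graded one together with natural transformations $t_{a,b}\colon !_aA\to !_bA$ for $a\ge b$ with $t_{a,a}=1$, $t_{a,b};t_{b,c}=t_{a,c}$, and (whenever defined) $\Delta;t\otimes t = t;\Delta$, $m;t\bullet t = t;m$, $t\otimes 1;\partial = \partial;t$. Every graded differential modality (in particular a differential modality) is filtered with the discrete order. Given an $R$-graded differential modality $M$, an $S$-graded one $M'$ and a rig homomorphism $\rho\colon S\to R$, a $\rho$-graded morphism from $M$ to $M'$ is a family of natural transformations $\phi_r\colon !_{\rho(r)}A\to !'_rA$ with $m;\phi\bullet\phi=\phi;m'$, $\phi;u'=u$, $\Delta;\phi\otimes\phi=\phi;\Delta'$, $\phi;\epsilon'=\epsilon$, $\partial;\phi=\phi\otimes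 1;\partial'$. It is a $\rho$-filtered morphism (for ordered rigs and filtered modalities) if moreover $t;\phi=\phi;t$ whenever defined. Here $\rho=0\colon\mathbb{N}\to 0$, so $\phi_n=s_n\colon !A\to !_{\le n}A$, from the differential modality $(!,\dots)$ to the $\mathbb{N}$-graded one. *)

(* Defs.v *)
From mathcomp Require Import ssreflect ssrfun ssrbool eqtype ssrnat.
From mathcomp Require Import zify.
Set Implicit Arguments. Unset Strict Implicit. Unset Printing Implicit Defensive.

(* Strictness is not imposed; associator/unitors are explicit, which is *)
(* the standard meaning of "treated as strict" (coherence theorem).     *)
Record smc := SMC {
  ob : Type;
  hom : ob -> ob -> Type;
  idm : forall A, hom A A;
  comp : forall A B C, hom A B -> hom B C -> hom A C;
  hzero : forall A B, hom A B;
  hplus : forall A B, hom A B -> hom A B -> hom A B;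
  tens : ob -> ob -> ob;
  tensm : forall A B C D, hom A B -> hom C D -> hom (tens A C) (tens B D);
  tunit : ob;
  assoc : forall A B C, hom (tens (tens A B) C) (tens A (tens B C));
  associ : forall A B C, hom (tens A (tens B C)) (tens (tens A B) C);
  lu : forall A, hom (tens tunit A) A;
  lui : forall A, hom A (tens tunit A);
  ru : forall A, hom (tens A tunit) A;
  rui : forall A, hom A (tens A tunit);
  sym : forall A B, hom (tens A B) (tens B A)
}.

Arguments idm {s} A.
Arguments hzero {s} A B.
Arguments tunit {s}.

Infix ";;" := comp (at level 55, right associativity).
Infix "<+>" := hplus (at level 60, right associativity).
Infix "<x>" := tensm (at level 45, left associativity).

Definition is_add_smc (C : smc) : Prop :=
  (forall (A B : ob C) (f : hom A B), idm A ;; f = f) /\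
  (forall (A B : ob C) (f : hom A B), f ;; idm B = f) /\
  (forall (A B D E : ob C) (f : hom A B) (g : hom B D) (h : hom D E),
      (f ;; g) ;; h = f ;; (g ;; h)) /\
  (forall (A B : ob C) (f g h : hom A B), (f <+> g) <+> h = f <+> (g <+> h)) /\
  (forall (A B : ob C) (f g : hom A B), f <+> g = g <+> f) /\
  (forall (A B : ob C) (f : hom A B), hzero A B <+> f = f) /\
  (forall (A B D : ob C) (f : hom A B), f ;; hzero B D = hzero A D) /\
  (forall (A B D : ob C) (g : hom B D), hzero A B ;; g = hzero A D) /\
  (forall (A B D : ob C) (f : hom A B) (g h : hom B D), f ;; (g <+> h) = (f ;; g) <+> (f ;; h)) /\
  (forall (A B D : ob C) (f g : hom A B) (h : hom B D), (f <+> g) ;; h = (f ;; h) <+> (g ;; h)) /\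
  (forall (A B D E : ob C) (g : hom D E), hzero A B <x> g = hzero (tens A D) (tens B E)) /\
  (forall (A B D E : ob C) (f : hom A B), f <x> hzero D E = hzero (tens A D) (tens B E)) /\
  (forall (A B D E : ob C) (f f' : hom A B) (g : hom D E), (f <+> f') <x> g = (f <x> g) <+> (f' <x> g)) /\
  (forall (A B D E : ob C) (f : hom A B) (g g' : hom D E), f <x> (g <+> g') = (f <x> g) <+> (f <x> g')) /\
  (forall (A B : ob C), idm A <x> idm B = idm (tens A B)) /\
  (forall (A1 A2 A3 B1 B2 B3 : ob C) (f : hom A1 A2) (f' : hom A2 A3) (g : hom B1 B2) (g' : hom B2 B3),
      (f ;; f') <x> (g ;; g') = (f <x> g) ;; (f' <x> g')) /\
  (forall (A B D : ob C), assoc A B D ;; associ A B D = idm _) /\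
  (forall (A B D : ob C), associ A B D ;; assoc A B D = idm _) /\
  (forall (A A' B B' D D' : ob C) (f : hom A A') (g : hom B B') (h : hom D D'),
      ((f <x> g) <x> h) ;; assoc A' B' D' = assoc A B D ;; (f <x> (g <x> h))) /\
  (forall (A : ob C), lu A ;; lui A = idm _) /\
  (forall (A : ob C), lui A ;; lu A = idm _) /\
  (forall (A : ob C), ru A ;; rui A = idm _) /\
  (forall (A : ob C), rui A ;; ru A = idm _) /\
  (forall (A B : ob C) (f : hom A B), (idm tunit <x> f) ;; lu B = lu A ;; f) /\
  (forall (A B : ob C) (f : hom A B), (f <x> idm tunit) ;; ru B = ru A ;; f) /\
  (forall (A A' B B' : ob C) (f : hom A A') (g : hom B B'),
      (f <x> g) ;; sym A' B' = sym A B ;; (g <x> f)) /\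
  (forall (A B : ob C), sym A B ;; sym B A = idm _) /\
  (forall (A B D E : ob C),
      assoc (tens A B) D E ;; assoc A B (tens D E)
      = (assoc A B D <x> idm E) ;; assoc A (tens B D) E ;; (idm A <x> assoc B D E)) /\
  (forall (A B : ob C), assoc A tunit B ;; (idm A <x> lu B) = ru A <x> idm B) /\
  (forall (A B D : ob C),
      assoc A B D ;; sym A (tens B D) ;; assoc B D A
      = (sym A B <x> idm D) ;; assoc B A D ;; (idm B <x> sym A D)).

Definition is_cokernel (C : smc) (X B Q : ob C) (f : hom X B) (q : hom B Q) : Prop :=
  f ;; q = hzero X B ;; q /\
  forall (Y : ob C) (g : hom B Y), f ;; g = hzero X B ;; g ->
    exists h : hom Q Y, q ;; h = g /\ forall h' : hom Q Y, q ;; h' = g -> h' = h.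

Definition icast (C : smc) (F : nat -> ob C -> ob C) (A : ob C) (n m : nat) (e : n = m)
  : hom (F n A) (F m A) :=
  match e in _ = k return hom (F n A) (F k A) with erefl => idm (F n A) end.

(* Differential modality (0-graded, indices dropped).                   *)
Record dm_data (C : smc) := DM {
  bang : ob C -> ob C;
  bmap : forall A B : ob C, hom A B -> hom (bang A) (bang B);
  dm_m : forall A, hom (bang A) (bang (bang A));
  dm_u : forall A, hom (bang A) A;
  dm_D : forall A, hom (bang A) (tens (bang A) (bang A));
  dm_e : forall A, hom (bang A) tunit;
  dm_d : forall A, hom (tens (bang A) A) (bang A)
}.

Definition is_dm (C : smc) (M : dm_data C) : Prop :=
  let B := bang M in let F := bmap M in
  let m := dm_m M in let u := dm_u M in let D := dm_D M in
  let e := dm_e M in let d := dm_d M in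
  (forall A : ob C, F _ _ (idm A) = idm (B A)) /\
  (forall (X Y Z : ob C) (f : hom X Y) (g : hom Y Z), F _ _ (f ;; g) = F _ _ f ;; F _ _ g) /\
  (forall (X Y : ob C) (f : hom X Y), F _ _ f ;; m Y = m X ;; F _ _ (F _ _ f)) /\
  (forall (X Y : ob C) (f : hom X Y), F _ _ f ;; u Y = u X ;; f) /\
  (forall (X Y : ob C) (f : hom X Y), F _ _ f ;; D Y = D X ;; (F _ _ f <x> F _ _ f)) /\
  (forall (X Y : ob C) (f : hom X Y), F _ _ f ;; e Y = e X) /\
  (forall (X Y : ob C) (f : hom X Y), (F _ _ f <x> f) ;; d Y = d X ;; F _ _ f) /\
  (forall A, m A ;; m (B A) = m A ;; F _ _ (m A)) /\
  (forall A, m A ;; F _ _ (u A) = idm (B A)) /\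
  (forall A, m A ;; u (B A) = idm (B A)) /\
  (forall A, D A ;; (D A <x> idm (B A)) ;; assoc _ _ _ = D A ;; (idm (B A) <x> D A)) /\
  (forall A, D A ;; (idm (B A) <x> e A) ;; ru _ = idm (B A)) /\
  (forall A, D A ;; sym _ _ = D A) /\
  (forall A, m A ;; D (B A) = D A ;; (m A <x> m A)) /\
  (forall A, m A ;; e (B A) = e A) /\
  (forall A, d A ;; u A = (e A <x> idm A) ;; lu A) /\
  (forall A, d A ;; D A =
     ((D A <x> idm A) ;; assoc _ _ _ ;; (idm (B A) <x> d A))
     <+> ((D A <x> idm A) ;; assoc _ _ _ ;; (idm (B A) <x> sym _ _) ;; associ _ _ _
          ;; (d A <x> idm (B A)))) /\
  (forall A, d A ;; m A = (D A <x> idm A) ;; assoc _ _ _ ;; (m A <x> d A) ;; d (B A)) /\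
  (forall A, assoc _ _ _ ;; (idm (B A) <x> sym A A) ;; associ _ _ _ ;; (d A <x> idm A) ;; d A
             = (d A <x> idm A) ;; d A).

Fixpoint tpow (C : smc) (A : ob C) (n : nat) : ob C :=
  match n with 0 => tunit | k.+1 => tens (tpow A k) A end.

Fixpoint dpow (C : smc) (M : dm_data C) (A : ob C) (n : nat)
  : hom (tens (bang M A) (tpow A n)) (bang M A) :=
  match n return hom (tens (bang M A) (tpow A n)) (bang M A) with
  | 0 => ru (bang M A)
  | k.+1 => associ _ _ _ ;; (dpow M A k <x> idm A) ;; dm_d M A
  end.

Record gdm_data (C : smc) (Lo : nat -> ob C -> ob C) := GDM {
  gmap : forall (n : nat) (A B : ob C), hom A B -> hom (Lo n A) (Lo n B);
  gm : forall (n p : nat) (A : ob C), hom (Lo (n * p) A) (Lo n (Lo p A));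
  gu : forall A : ob C, hom (Lo 1 A) A;
  gD : forall (n p : nat) (A : ob C), hom (Lo (n + p) A) (tens (Lo n A) (Lo p A));
  ge : forall A : ob C, hom (Lo 0 A) tunit;
  gd : forall (n : nat) (A : ob C), hom (tens (Lo n A) A) (Lo n.+1 A)
}.

Lemma idx_D2 (r s : nat) : (r + s).+2 = r.+1 + s.+1.
Proof. by rewrite addSn addnS. Qed.
Lemma idx_D3a (s t : nat) : (s * t + s + t).+1 = s.+1 * t.+1.
Proof. lia. Qed.
Lemma idx_D3b (s t : nat) : s * t + s = s * t.+1.
Proof. by rewrite mulnS addnC. Qed.

Definition is_gdm (C : smc) (Lo : nat -> ob C -> ob C) (G : gdm_data Lo) : Prop :=
  let F := gmap G in let m := gm G in let u := gu G in
  let D := gD G in let e := ge G in let d := gd G in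
  (forall n (A : ob C), F n _ _ (idm A) = idm (Lo n A)) /\
  (forall n (X Y Z : ob C) (f : hom X Y) (g : hom Y Z), F n _ _ (f ;; g) = F n _ _ f ;; F n _ _ g) /\
  (forall n p (X Y : ob C) (f : hom X Y), F (n * p) _ _ f ;; m n p Y = m n p X ;; F n _ _ (F p _ _ f)) /\
  (forall (X Y : ob C) (f : hom X Y), F 1 _ _ f ;; u Y = u X ;; f) /\
  (forall n p (X Y : ob C) (f : hom X Y), F (n + p) _ _ f ;; D n p Y = D n p X ;; (F n _ _ f <x> F p _ _ f)) /\
  (forall (X Y : ob C) (f : hom X Y), F 0 _ _ f ;; e Y = e X) /\
  (forall n (X Y : ob C) (f : hom X Y), (F n _ _ f <x> f) ;; d n Y = d n X ;; F n.+1 _ _ f) /\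
  (forall n p q (A : ob C),
     m (n * p) q A ;; m n p (Lo q A)
     = icast Lo A (esym (mulnA n p q)) ;; m n (p * q) A ;; F n _ _ (m p q A)) /\
  (forall r (A : ob C), icast Lo A (esym (muln1 r)) ;; m r 1 A ;; F r _ _ (u A) = idm (Lo r A)) /\
  (forall r (A : ob C), icast Lo A (esym (mul1n r)) ;; m 1 r A ;; u (Lo r A) = idm (Lo r A)) /\
  (forall r s t (A : ob C),
     D (r + s) t A ;; (D r s A <x> idm (Lo t A)) ;; assoc _ _ _
     = icast Lo A (esym (addnA r s t)) ;; D r (s + t) A ;; (idm (Lo r A) <x> D s t A)) /\
  (forall (A : ob C),
     icast Lo A (esym (addn0 0)) ;; D 0 0 A ;; (idm (Lo 0 A) <x> e A) ;; ru _ = idm (Lo 0 A)) /\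
  (forall r s (A : ob C), D r s A ;; sym _ _ = icast Lo A (addnC r s) ;; D s r A) /\
  (forall r s t (A : ob C),
     m (r + s) t A ;; D r s (Lo t A)
     = icast Lo A (mulnDl r s t) ;; D (r * t) (s * t) A ;; (m r t A <x> m s t A)) /\
  (forall r (A : ob C), icast Lo A (esym (mul0n r)) ;; m 0 r A ;; e (Lo r A) = e A) /\
  (forall (A : ob C), d 0 A ;; u A = (e A <x> idm A) ;; lu A) /\
  (forall r s (A : ob C),
     d (r + s).+1 A ;; icast Lo A (idx_D2 r s) ;; D r.+1 s.+1 A
     = (((icast Lo A (esym (addSn r s)) ;; D r.+1 s A) <x> idm A) ;; assoc _ _ _
          ;; (idm (Lo r.+1 A) <x> d s A))
       <+> (((icast Lo A (esym (addnS r s)) ;; D r s.+1 A) <x> idm A) ;; assoc _ _ _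
          ;; (idm (Lo r A) <x> sym _ _) ;; associ _ _ _ ;; (d r A <x> idm (Lo s.+1 A)))) /\
  (forall s t (A : ob C),
     d (s * t + s + t) A ;; icast Lo A (idx_D3a s t) ;; m s.+1 t.+1 A
     = (D (s * t + s) t A <x> idm A) ;; assoc _ _ _
       ;; ((icast Lo A (idx_D3b s t) ;; m s t.+1 A) <x> d t A) ;; d s (Lo t.+1 A)) /\
  (forall r (A : ob C),
     assoc _ _ _ ;; (idm (Lo r A) <x> sym A A) ;; associ _ _ _ ;; (d r A <x> idm A) ;; d r.+1 A
     = (d r A <x> idm A) ;; d r.+1 A).

Definition gdm_same (C : smc) (Lo : nat -> ob C -> ob C) (G G' : gdm_data Lo) : Prop :=
  (forall n (A B : ob C) (f : hom A B), gmap G n f = gmap G' n f) /\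
  (forall n p (A : ob C), gm G n p A = gm G' n p A) /\
  (forall A : ob C, gu G A = gu G' A) /\
  (forall n p (A : ob C), gD G n p A = gD G' n p A) /\
  (forall A : ob C, ge G A = ge G' A) /\
  (forall n (A : ob C), gd G n A = gd G' n A).

Definition is_gmor (C : smc) (M : dm_data C) (Lo : nat -> ob C -> ob C) (G : gdm_data Lo)
  (s : forall (n : nat) (A : ob C), hom (bang M A) (Lo n A)) : Prop :=
  (forall n (X Y : ob C) (f : hom X Y), bmap M f ;; s n Y = s n X ;; gmap G n f) /\
  (forall n p (A : ob C),
     dm_m M A ;; bmap M (s p A) ;; s n (Lo p A) = s (n * p) A ;; gm G n p A) /\
  (forall A : ob C, s 1 A ;; gu G A = dm_u M A) /\
  (forall n p (A : ob C), dm_D M A ;; (s n A <x> s p A) = s (n + p) A ;; gD G n p A) /\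
  (forall A : ob C, s 0 A ;; ge G A = dm_e M A) /\
  (forall n (A : ob C), dm_d M A ;; s n.+1 A = (s n A <x> idm A) ;; gd G n A).

(* N-filtered structure t_{n,p} : !_{<=n} A -> !_{<=p} A (only meaningful
   for p <= n; values for p > n are irrelevant and never constrained). *)
Definition is_filtered (C : smc) (Lo : nat -> ob C -> ob C) (G : gdm_data Lo)
  (t : forall (n p : nat) (A : ob C), hom (Lo n A) (Lo p A)) : Prop :=
  (forall n (A : ob C), t n n A = idm (Lo n A)) /\
  (forall n p q (A : ob C), p <= n -> q <= p -> t n p A ;; t p q A = t n q A) /\
  (forall n p (X Y : ob C) (f : hom X Y), p <= n ->
     gmap G n f ;; t n p Y = t n p X ;; gmap G p f) /\
  (forall r r' s s' (A : ob C), r' <= r -> s' <= s ->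
     gD G r s A ;; (t r r' A <x> t s s' A) = t (r + s) (r' + s') A ;; gD G r' s' A) /\
  (forall r r' s s' (A : ob C), r' <= r -> s' <= s ->
     gm G r s A ;; gmap G r (t s s' A) ;; t r r' (Lo s' A) = t (r * s) (r' * s') A ;; gm G r' s' A) /\
  (forall r r' (A : ob C), r' <= r ->
     (t r r' A <x> idm A) ;; gd G r' A = gd G r A ;; t r.+1 r'.+1 A).

(* Filtered morphism condition (the source M carries the discrete filtration,
   so t^M = 1 and the condition t;phi = phi;t reads s_n ; t_{n,p} = s_p). *)
Definition is_fmor (C : smc) (M : dm_data C) (Lo : nat -> ob C -> ob C)
  (s : forall (n : nat) (A : ob C), hom (bang M A) (Lo n A))
  (t : forall (n p : nat) (A : ob C), hom (Lo n A) (Lo p A)) : Prop :=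
  forall n p (A : ob C), p <= n -> s n A ;; t n p A = s p A.

(* Main.v *)
(** Every structure map on the [Lo n A] is the factorisation of the
    corresponding map on [bang M A] through [s n A]. That these factorisations
    exist amounts to: a derivative of order [n + p + 1] of [dm_D] dies in
    [Lo n A (x) Lo p A], and one of order [n p + 1] of [dm_m] dies in
    [Lo n (Lo p A)]. Both follow by induction from the Leibniz and chain rules,
    taking one derivative at a time and pushing it through [s] with
    [dm_d ;; s n.+1 = (s n (x) 1) ;; gd n]; no closed higher-order formula is
    needed. The laws then transfer along the epimorphisms [s n A] and
    [s n A (x) 1]. The exception is the symmetry of second derivatives, which
    lives on [Lo n A (x) A (x) A]: that [s n A (x) 1 (x) 1] is epi is not assumed
    and is deduced from the second hypothesis at the object
    [bang M A (x) A]. *)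

Require Import Defs.
From mathcomp Require Import ssreflect ssrfun ssrbool eqtype ssrnat.
From Stdlib Require Import ClassicalEpsilon.
Set Implicit Arguments. Unset Strict Implicit. Unset Printing Implicit Defensive.

Section TaylorFiltration.
Context (C : smc) (HC : is_add_smc C).
Implicit Types A B D E X Y Z : ob C.

(** * Calculus of additive symmetric monoidal categories *)

Lemma comp1f A B (f : hom A B) : idm A ;; f = f.
Proof. by apply HC. Qed.
Lemma compf1 A B (f : hom A B) : f ;; idm B = f.
Proof. by apply HC. Qed.
Lemma compA A B D E (f : hom A B) (g : hom B D) (h : hom D E) :
  (f ;; g) ;; h = f ;; (g ;; h).
Proof. by apply HC. Qed.
Lemma add0f A B (f : hom A B) : hzero A B <+> f = f.
Proof. by apply HC. Qed.
Lemma compf0 A B D (f : hom A B) : f ;; hzero B D = hzero A D.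
Proof. by apply HC. Qed.
Lemma comp0f A B D (g : hom B D) : hzero A B ;; g = hzero A D.
Proof. by apply HC. Qed.
Lemma compDr A B D (f : hom A B) (g h : hom B D) :
  f ;; (g <+> h) = (f ;; g) <+> (f ;; h).
Proof. by apply HC. Qed.
Lemma compDl A B D (f g : hom A B) (h : hom B D) :
  (f <+> g) ;; h = (f ;; h) <+> (g ;; h).
Proof. by apply HC. Qed.
Lemma tens0f A B D E (g : hom D E) : hzero A B <x> g = hzero _ _.
Proof. by apply HC. Qed.
Lemma tensf0 A B D E (f : hom A B) : f <x> hzero D E = hzero _ _.
Proof. by apply HC. Qed.
Lemma tens1 A B : idm A <x> idm B = idm (tens A B).
Proof. by apply HC. Qed.
Lemma tensM A1 A2 A3 B1 B2 B3 (f : hom A1 A2) (f' : hom A2 A3)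
    (g : hom B1 B2) (g' : hom B2 B3) :
  (f <x> g) ;; (f' <x> g') = (f ;; f') <x> (g ;; g').
Proof. by symmetry; apply HC. Qed.
Lemma assocK A B D : assoc A B D ;; associ A B D = idm _.
Proof. by apply HC. Qed.
Lemma associK A B D : associ A B D ;; assoc A B D = idm _.
Proof. by apply HC. Qed.
Lemma assocN A A' B B' D D' (f : hom A A') (g : hom B B') (h : hom D D') :
  ((f <x> g) <x> h) ;; assoc A' B' D' = assoc A B D ;; (f <x> (g <x> h)).
Proof. by apply HC. Qed.
Lemma ruiK A : rui A ;; ru A = idm _. Proof. by apply HC. Qed.
Lemma ruN A B (f : hom A B) : (f <x> idm tunit) ;; ru B = ru A ;; f.
Proof. by apply HC. Qed.
Lemma symN A A' B B' (f : hom A A') (g : hom B B') :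
  (f <x> g) ;; sym A' B' = sym A B ;; (g <x> f).
Proof. by apply HC. Qed.
Lemma symK A B : sym A B ;; sym B A = idm _.
Proof. by apply HC. Qed.
Lemma triangle A B : assoc A tunit B ;; (idm A <x> lu B) = ru A <x> idm B.
Proof. by apply HC. Qed.

Lemma compK A B D E (f : hom A B) (g : hom B D) (h : hom A D) (k : hom D E) :
  f ;; g = h -> f ;; (g ;; k) = h ;; k.
Proof. by move=> <-; rewrite compA. Qed.

Lemma tensMK A1 A2 A3 B1 B2 B3 Y (f : hom A1 A2) (f' : hom A2 A3)
    (g : hom B1 B2) (g' : hom B2 B3) (k : hom (tens A3 B3) Y) :
  (f <x> g) ;; ((f' <x> g') ;; k) = ((f ;; f') <x> (g ;; g')) ;; k.
Proof. exact/compK/tensM. Qed.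

Lemma assocNK A A' B B' D D' Y (f : hom A A') (g : hom B B') (h : hom D D')
    (k : hom (tens A' (tens B' D')) Y) :
  ((f <x> g) <x> h) ;; (assoc A' B' D' ;; k) = assoc A B D ;; ((f <x> (g <x> h)) ;; k).
Proof. by rewrite -!compA assocN. Qed.

Lemma associN A A' B B' D D' (f : hom A A') (g : hom B B') (h : hom D D') :
  (f <x> (g <x> h)) ;; associ A' B' D' = associ A B D ;; ((f <x> g) <x> h).
Proof.
rewrite -[LHS]comp1f -associK !compA; congr (_ ;; _).
by rewrite -!compA -assocN !compA assocK compf1.
Qed.

(** This exchange of the last two factors occurs both in the Leibniz rule and in the symmetry of
    second derivatives. *)
Lemma midN A A' B B' D D' (f : hom A A') (g : hom B B') (h : hom D D') :
  ((f <x> g) <x> h) ;; (assoc A' B' D' ;; (idm A' <x> sym B' D') ;; associ A' D' B')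
  = assoc A B D ;; (idm A <x> sym B D) ;; associ A D B ;; ((f <x> h) <x> g).
Proof.
by rewrite assocNK tensMK symN -associN compf1 !tensMK comp1f.
Qed.

Lemma tens_factor_l A A' A'' B B' (f : hom A A') (f' : hom A' A'') (g : hom B B') :
  (f ;; f') <x> g = (f <x> g) ;; (f' <x> idm B').
Proof. by rewrite tensM compf1. Qed.

(** * Cokernels: cancellation and descent *)

Lemma cokernel_epi X B Q Y (f : hom X B) (q : hom B Q) (h h' : hom Q Y) :
  is_cokernel f q -> q ;; h = q ;; h' -> h = h'.
Proof.
case=> Hq Hu E.
have [|k [_ Hk]] := Hu Y (q ;; h); last by rewrite (Hk h) // (Hk h').
by rewrite -!compA Hq.
Qed.

Lemma cokernel_zero X B Q (f : hom X B) (q : hom B Q) :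
  is_cokernel f q -> f ;; q = hzero _ _.
Proof. by case=> -> _; rewrite comp0f. Qed.

Lemma cokernel_desc X B Q Y (f : hom X B) (q : hom B Q) (g : hom B Y) :
  is_cokernel f q -> f ;; g = hzero _ _ -> exists h, q ;; h = g.
Proof.
case=> _ Hu E; have [|h [hE _]] := Hu Y g; last by exists h.
by rewrite comp0f.
Qed.


(** * The differential modality and vanishing of its derivatives *)

Context (M : dm_data C) (HM : is_dm M).

Local Notation "! A" := (bang M A) (at level 8, A at level 8, format "! A").
Local Notation F := (@bmap C M _ _).
Local Notation m := (dm_m M).
Local Notation u := (dm_u M).
Local Notation Dl := (dm_D M).
Local Notation e := (dm_e M).
Local Notation d := (dm_d M).
Local Notation dp := (dpow M).

Lemma bmapM X Y Z (f : hom X Y) (g : hom Y Z) : F (f ;; g) = F f ;; F g.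
Proof. by apply HM. Qed.
Lemma bmap1 A : F (idm A) = idm !A.
Proof. by apply HM. Qed.
Lemma dm_mN X Y (f : hom X Y) : F f ;; m Y = m X ;; F (F f).
Proof. by apply HM. Qed.
Lemma dm_uN X Y (f : hom X Y) : F f ;; u Y = u X ;; f.
Proof. by apply HM. Qed.
Lemma dm_DN X Y (f : hom X Y) : F f ;; Dl Y = Dl X ;; (F f <x> F f).
Proof. by apply HM. Qed.
Lemma dm_eN X Y (f : hom X Y) : F f ;; e Y = e X.
Proof. by apply HM. Qed.
Lemma dm_dN X Y (f : hom X Y) : (F f <x> f) ;; d Y = d X ;; F f.
Proof. by apply HM. Qed.
Lemma dm_mA A : m A ;; m !A = m A ;; F (m A).
Proof. by apply HM. Qed.
Lemma dm_mFu A : m A ;; F (u A) = idm !A.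
Proof. by apply HM. Qed.
Lemma dm_mu A : m A ;; u !A = idm !A.
Proof. by apply HM. Qed.
Lemma dm_DA A : Dl A ;; (Dl A <x> idm !A) ;; assoc _ _ _ = Dl A ;; (idm !A <x> Dl A).
Proof. by apply HM. Qed.
Lemma dm_De A : Dl A ;; (idm !A <x> e A) ;; ru _ = idm !A.
Proof. by apply HM. Qed.
Lemma dm_Dsym A : Dl A ;; sym _ _ = Dl A.
Proof. by apply HM. Qed.
Lemma dm_mD A : m A ;; Dl !A = Dl A ;; (m A <x> m A).
Proof. by apply HM. Qed.
Lemma dm_me A : m A ;; e !A = e A.
Proof. by apply HM. Qed.
Lemma dm_du A : d A ;; u A = (e A <x> idm A) ;; lu A.
Proof. by apply HM. Qed.
Lemma dm_dD A : d A ;; Dl A =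
  ((Dl A <x> idm A) ;; assoc _ _ _ ;; (idm !A <x> d A))
  <+> ((Dl A <x> idm A) ;; assoc _ _ _ ;; (idm !A <x> sym _ _) ;; associ _ _ _
       ;; (d A <x> idm !A)).
Proof. by apply HM. Qed.
Lemma dm_dm A :
  d A ;; m A = (Dl A <x> idm A) ;; assoc _ _ _ ;; (m A <x> d A) ;; d !A.
Proof. by apply HM. Qed.
Lemma dm_dd A :
  assoc _ _ _ ;; (idm !A <x> sym A A) ;; associ _ _ _ ;; (d A <x> idm A) ;; d A
  = (d A <x> idm A) ;; d A.
Proof. by apply HM. Qed.

Lemma dm_Dfe A Y (f : hom !A Y) : Dl A ;; (f <x> e A) ;; ru Y = f.
Proof.
rewrite -[f in LHS]comp1f -[e A]compf1 -tensM compA ruN.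
by rewrite -[in RHS](comp1f f) -[in RHS]dm_De !compA.
Qed.

(** By naturality a derivative of [!0] is taken in the direction 0, and [<x>] preserves zero
    maps. *)
Lemma dm_dF0 A B : d A ;; F (hzero A B) = hzero _ _.
Proof. by rewrite -dm_dN tensf0 comp0f. Qed.

(* Naturality at the zero map gives [e = !0 ;; e], and [!0] kills derivatives. *)
Lemma dm_de A : d A ;; e A = hzero _ _.
Proof. by rewrite -(dm_eN (hzero A A)) -compA dm_dF0 comp0f. Qed.

(** The factor [k] would be [F f] tensored with [n] copies of [f]; its mere existence suffices to
    see that [F f] followed by [s] kills higher derivatives. *)
Lemma dpow_natural n X Y (f : hom X Y) :
  exists k, dp X n ;; F f = k ;; dp Y n.
Proof.
elim: n => [|n [k E]] /=; first by exists (F f <x> idm _); rewrite ruN.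
exists (associ _ _ _ ;; (k <x> f) ;; assoc _ _ _).
rewrite !compA -dm_dN !tensMK E comp1f; congr (_ ;; _).
by rewrite (compK _ (assocK _ _ _)) comp1f tensMK compf1.
Qed.

(** The associator inside [dpow] is invertible, so it can be cancelled and the last derivative
    peeled off; every vanishing proof by induction starts here. *)
Lemma dpowS_kill n A Y (g : hom !A Y) :
  dp A n.+1 ;; g = hzero _ _ <-> (dp A n <x> idm A) ;; d A ;; g = hzero _ _.
Proof.
rewrite /= !compA; split=> [E|->]; last by rewrite compf0.
by rewrite -[LHS]comp1f -(assocK) compA E compf0.
Qed.

Lemma dpow1_kill A Y (g : hom !A Y) :
  dp A 1 ;; g = hzero _ _ <-> d A ;; g = hzero _ _.
Proof.
rewrite dpowS_kill /=; split=> [E|->]; last by rewrite compf0.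
rewrite -[LHS]comp1f -tens1 -ruiK -(comp1f (idm A)) -tensM !compA E compf0 //.
Qed.

(** * Factorisations through the cokernels *)

Context (Lo : nat -> ob C -> ob C) (s : forall n A, hom !A (Lo n A)).
Context (Hs : forall A n, is_cokernel (dp A n.+1) (s n A)).
Context (Hs1 : forall A n, is_cokernel (dp A n.+1 <x> idm A) (s n A <x> idm A)).

Lemma s_epi n A Y (h h' : hom (Lo n A) Y) : s n A ;; h = s n A ;; h' -> h = h'.
Proof. exact/cokernel_epi/Hs. Qed.

Lemma s1_epi n A Y (h h' : hom (tens (Lo n A) A) Y) :
  (s n A <x> idm A) ;; h = (s n A <x> idm A) ;; h' -> h = h'.
Proof. exact/cokernel_epi/Hs1. Qed.

Lemma dpow_s n A : dp A n.+1 ;; s n A = hzero _ _.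
Proof. exact/cokernel_zero/Hs. Qed.

Lemma d_s0 A : d A ;; s 0 A = hzero _ _.
Proof. exact/dpow1_kill/dpow_s. Qed.

(** Precomposing with [s] absorbs every index cast, so the casts in the graded laws disappear once
    the epimorphism is in front. *)
Lemma s_icast n k A (E : n = k) : s n A ;; icast Lo A E = s k A.
Proof. by case: k / E; rewrite compf1. Qed.

Lemma s_icastK n k A Y (E : n = k) (g : hom (Lo k A) Y) :
  s n A ;; (icast Lo A E ;; g) = s k A ;; g.
Proof. exact/compK/s_icast. Qed.

Lemma gmap_desc n X Y (f : hom X Y) : exists g, s n X ;; g = F f ;; s n Y.
Proof.
apply: (cokernel_desc (Hs X n)); have [k E] := dpow_natural n.+1 f.
by rewrite -compA E compA dpow_s compf0.
Qed.

(** The first derivative of [u] is essentially [e] beside an identity; a second one hits [e], whose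
    derivative is zero. *)
Lemma gu_desc A : exists g, s 1 A ;; g = u A.
Proof.
apply: (cokernel_desc (Hs A 1)); apply/dpowS_kill.
rewrite dm_du tensMK comp1f.
suff /dpow1_kill-> : d A ;; e A = hzero _ _ by rewrite tens0f comp0f.
exact: dm_de.
Qed.

Lemma ge_desc A : exists g, s 0 A ;; g = e A.
Proof. by apply: (cokernel_desc (Hs A 0)); apply/dpow1_kill/dm_de. Qed.

(** This gives a way back from [Lo 0 A] to [bang M A], needed to build the sections in [s11_epi]. *)
Lemma zero_desc A : exists z, s 0 A ;; z = F (hzero A A).
Proof. by apply: (cokernel_desc (Hs A 0)); apply/dpow1_kill/dm_dF0. Qed.

Lemma gd_desc n A : exists g, (s n A <x> idm A) ;; g = d A ;; s n.+1 A.
Proof.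
by apply: (cokernel_desc (Hs1 A n)); apply/dpowS_kill/dpow_s.
Qed.

(** * Vanishing of high derivatives of [Dl], [m] and [s] *)

Section Kill.
(** [gd_] stays abstract so that these lemmas serve twice: to construct the graded structure, and to
    verify the laws of a given one. *)
Context (gd_ : forall n A, hom (tens (Lo n A) A) (Lo n.+1 A)).
Context (gdE : forall n A, d A ;; s n.+1 A = (s n A <x> idm A) ;; gd_ n A).

(** Read from right to left, one derivative is pushed through [s], leaving [Dl ;; (s n <x> s p)]
    undifferentiated in front. [D_ss_r] does this for the other Leibniz term. *)
Lemma D_ss_l n p A :
  ((Dl A ;; (s n A <x> s p A)) <x> idm A) ;; assoc _ _ _ ;; (idm _ <x> gd_ p A)
  = (Dl A <x> idm A) ;; assoc _ _ _ ;; (s n A <x> (d A ;; s p.+1 A)).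
Proof.
by rewrite tens_factor_l // compA assocNK // tensM // compf1 // gdE.
Qed.

Lemma D_ss_r n p A :
  ((Dl A ;; (s n A <x> s p A)) <x> idm A) ;; assoc _ _ _ ;; (idm _ <x> sym _ _)
    ;; associ _ _ _ ;; (gd_ n A <x> idm (Lo p A))
  = (Dl A <x> idm A) ;; assoc _ _ _ ;; (idm !A <x> sym _ _) ;; associ _ _ _
    ;; ((d A ;; s n.+1 A) <x> s p A).
Proof.
rewrite tens_factor_l // compA; congr (_ ;; _).
rewrite gdE tens_factor_l //.
have := midN (s n A) (s p A) (idm A) => /(congr1 (fun h => h ;; (gd_ n A <x> idm (Lo p A)))).
by rewrite !compA.
Qed.

Lemma leibniz_s n p A :
  d A ;; Dl A ;; (s n A <x> s p A)
  = ((Dl A <x> idm A) ;; assoc _ _ _ ;; (s n A <x> (d A ;; s p A)))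
    <+> ((Dl A <x> idm A) ;; assoc _ _ _ ;; (idm !A <x> sym _ _) ;; associ _ _ _
         ;; ((d A ;; s n A) <x> s p A)).
Proof. by rewrite -compA dm_dD compDl !compA !tensM !comp1f. Qed.

Lemma D_kill n p A : dp A (n + p).+1 ;; Dl A ;; (s n A <x> s p A) = hzero _ _.
Proof.
(* The induction is on [n + p], since each Leibniz term lowers only one of the two indices. At index
   0 the term dies because [d ;; s 0] is zero. *)
have [k] := ubnP (n + p); elim: k n p => // k IH n p lt_k.
apply/dpowS_kill; rewrite leibniz_s compDr.
set x := (X in X <+> _); have -> : x = hzero _ _.
  rewrite /x; case: p lt_k {x} => [|p] lt_k; first by rewrite d_s0 tensf0 !compf0.
  rewrite -D_ss_l tensMK addnS IH ?tens0f ?comp0f // -ltnS.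
  by rewrite addnS in lt_k.
rewrite add0f; case: n lt_k {x} => [|n] lt_k; first by rewrite d_s0 tens0f !compf0.
by rewrite -D_ss_r tensMK addSn IH ?tens0f ?comp0f // -ltnS.
Qed.

Lemma gD_desc n p A : exists g, s (n + p) A ;; g = Dl A ;; (s n A <x> s p A).
Proof. exact/(cokernel_desc (Hs A (n + p)))/D_kill. Qed.

Lemma chain_s n p A :
  d A ;; m A ;; F (s p A) ;; s n.+1 (Lo p A)
  = (Dl A <x> idm A) ;; assoc _ _ _
    ;; ((m A ;; F (s p A) ;; s n (Lo p A)) <x> (d A ;; s p A)) ;; gd_ n (Lo p A).
Proof.
rewrite -compA dm_dm !compA -[d !A ;; _]compA -dm_dN compA gdE.
by rewrite !tensMK !compA compf1.
Qed.

Lemma m_kill n p A : dp A (n * p).+1 ;; m A ;; F (s p A) ;; s n (Lo p A) = hzero _ _.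
Proof.
apply/dpowS_kill; elim: n => [|n IH].
  rewrite -[d A ;; _]compA dm_dm !compA -[d !A ;; _]compA -dm_dN compA d_s0.
  by rewrite !compf0.
rewrite chain_s; case: p IH => [|p] IH.
  by rewrite d_s0 tensf0 comp0f !compf0.
(* The induction hypothesis factors the outer map through [s (n * p.+1)]. What remains contains
   [Dl ;; (s (n * p.+1) <x> s p)], killed by derivatives of order [n * p.+1 + p + 1], which is
   exactly [n.+1 * p.+1]. *)
have [h <-] := cokernel_desc (Hs A (n * p.+1)) (proj2 (dpowS_kill _ _) IH).
rewrite gdE -tensM.
rewrite compA -assocNK !tensMK !comp1f compA.
by rewrite mulSn addSn addnC D_kill tens0f comp0f.
Qed.

Lemma gm_desc n p A : exists g, s (n * p) A ;; g = m A ;; F (s p A) ;; s n (Lo p A).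
Proof. exact/(cokernel_desc (Hs A (n * p)))/m_kill. Qed.

Lemma t_kill n p A : p <= n -> dp A n.+1 ;; s p A = hzero _ _.
Proof.
elim: n p => [|n IH] [|p] // le_pn; apply/dpowS_kill;
  rewrite ?d_s0 ?compf0 // gdE tensMK IH // tens0f comp0f //.
Qed.

Lemma t_desc n p A : exists g, p <= n -> s n A ;; g = s p A.
Proof.
(* The zero map is a default value that makes [t] total. *)
have [le_pn|_] := boolP (p <= n); last by exists (hzero _ _).
by have [h E] := cokernel_desc (Hs A n) (t_kill A le_pn); exists h.
Qed.

End Kill.

(** * Transfer of the laws along the epimorphisms *)

Section Laws.
Context (G : gdm_data Lo) (HG : is_gmor G s).

Lemma s_map n X Y (f : hom X Y) : s n X ;; gmap G n f = F f ;; s n Y.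
Proof. by symmetry; apply HG. Qed.
Lemma s_m n p A : s (n * p) A ;; gm G n p A = m A ;; F (s p A) ;; s n (Lo p A).
Proof. by symmetry; apply HG. Qed.
Lemma s_u A : s 1 A ;; gu G A = u A.
Proof. by apply HG. Qed.
Lemma s_D n p A : s (n + p) A ;; gD G n p A = Dl A ;; (s n A <x> s p A).
Proof. by symmetry; apply HG. Qed.
Lemma s_e A : s 0 A ;; ge G A = e A.
Proof. by apply HG. Qed.
Lemma s_d n A : d A ;; s n.+1 A = (s n A <x> idm A) ;; gd G n A.
Proof. by apply HG. Qed.

Lemma s_mapK n X Y Z (f : hom X Y) (k : hom (Lo n Y) Z) :
  s n X ;; gmap G n f ;; k = F f ;; s n Y ;; k.
Proof. by rewrite (compK _ (s_map _ _)) compA. Qed.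
Lemma s_mK n p A Z (k : hom (Lo n (Lo p A)) Z) :
  s (n * p) A ;; gm G n p A ;; k = m A ;; F (s p A) ;; s n (Lo p A) ;; k.
Proof. by rewrite (compK _ (s_m _ _ _)) !compA. Qed.
Lemma s_DK n p A Z (k : hom (tens (Lo n A) (Lo p A)) Z) :
  s (n + p) A ;; gD G n p A ;; k = Dl A ;; (s n A <x> s p A) ;; k.
Proof. by rewrite (compK _ (s_D _ _ _)) !compA. Qed.
Lemma s_dK n A Z (k : hom (Lo n.+1 A) Z) :
  (s n A <x> idm A) ;; gd G n A ;; k = d A ;; s n.+1 A ;; k.
Proof. by rewrite -[RHS]compA s_d compA. Qed.

Lemma g_map1 n A : gmap G n (idm A) = idm (Lo n A).
Proof. by apply: s_epi; rewrite s_map bmap1 comp1f compf1. Qed.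

Lemma g_mapM n X Y Z (f : hom X Y) (g : hom Y Z) :
  gmap G n (f ;; g) = gmap G n f ;; gmap G n g.
Proof. by apply: s_epi; rewrite s_mapK !s_map bmapM compA. Qed.

Lemma g_mN n p X Y (f : hom X Y) :
  gmap G (n * p) f ;; gm G n p Y = gm G n p X ;; gmap G n (gmap G p f).
Proof.
apply: s_epi; rewrite s_mapK s_m s_mK s_map.
rewrite -!compA dm_mN; congr (_ ;; _).
by rewrite !compA -!bmapM s_map.
Qed.

Lemma g_uN X Y (f : hom X Y) : gmap G 1 f ;; gu G Y = gu G X ;; f.
Proof. by apply: s_epi; rewrite s_mapK s_u (compK _ (s_u _)) dm_uN. Qed.

Lemma g_DN n p X Y (f : hom X Y) :
  gmap G (n + p) f ;; gD G n p Y = gD G n p X ;; (gmap G n f <x> gmap G p f).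
Proof.
apply: s_epi; rewrite s_mapK s_D s_DK tensM !s_map -tensM.
by rewrite (compK _ (dm_DN f)) compA.
Qed.

Lemma g_eN X Y (f : hom X Y) : gmap G 0 f ;; ge G Y = ge G X.
Proof. by apply: s_epi; rewrite s_mapK !s_e dm_eN. Qed.

Lemma g_dN n X Y (f : hom X Y) :
  (gmap G n f <x> f) ;; gd G n Y = gd G n X ;; gmap G n.+1 f.
Proof.
apply: s1_epi; rewrite s_dK s_map tensMK s_map comp1f tens_factor_l // compA -s_d.
by rewrite -!compA dm_dN.
Qed.

Lemma g_mA n p q A :
  gm G (n * p) q A ;; gm G n p (Lo q A)
  = icast Lo A (esym (mulnA n p q)) ;; gm G n (p * q) A ;; gmap G n (gm G p q A).
Proof.
apply: s_epi; rewrite s_mK s_m s_icastK s_mK s_map.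
rewrite (compK _ (dm_mN _)) compA (compK _ (dm_mA _)) !compA; congr (_ ;; _).
by rewrite -[in RHS]compA -bmapM s_m !bmapM !compA.
Qed.

Lemma g_mFu r A : icast Lo A (esym (muln1 r)) ;; gm G r 1 A ;; gmap G r (gu G A) = idm (Lo r A).
Proof.
apply: s_epi; rewrite s_icastK s_mK s_map -[F _ ;; F _ ;; _]compA -bmapM s_u.
by rewrite -compA dm_mFu comp1f compf1.
Qed.

Lemma g_mu r A : icast Lo A (esym (mul1n r)) ;; gm G 1 r A ;; gu G (Lo r A) = idm (Lo r A).
Proof.
by apply: s_epi; rewrite s_icastK s_mK s_u dm_uN -compA dm_mu comp1f compf1.
Qed.

Lemma g_DA r q t A :
  gD G (r + q) t A ;; (gD G r q A <x> idm (Lo t A)) ;; assoc _ _ _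
  = icast Lo A (esym (addnA r q t)) ;; gD G r (q + t) A ;; (idm (Lo r A) <x> gD G q t A).
Proof.
apply: s_epi; rewrite s_DK s_icastK s_DK tensMK tensM s_D s_D !compf1.
rewrite -[s t A in LHS]comp1f -tensM compA assocN.
by rewrite -[X in _ = _ ;; (X <x> _)]comp1f -tensM -[RHS]compA -dm_DA !compA.
Qed.

Lemma g_De A :
  icast Lo A (esym (addn0 0)) ;; gD G 0 0 A ;; (idm (Lo 0 A) <x> ge G A) ;; ru _ = idm (Lo 0 A).
Proof.
by apply: s_epi; rewrite s_icastK s_DK tensMK !compf1 s_e dm_Dfe.
Qed.

Lemma g_Dsym r q A : gD G r q A ;; sym _ _ = icast Lo A (addnC r q) ;; gD G q r A.
Proof. by apply: s_epi; rewrite s_DK s_icastK s_D symN (compK _ (dm_Dsym _)). Qed.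

Lemma g_mD r q t A :
  gm G (r + q) t A ;; gD G r q (Lo t A)
  = icast Lo A (mulnDl r q t) ;; gD G (r * t) (q * t) A ;; (gm G r t A <x> gm G q t A).
Proof.
apply: s_epi; rewrite s_mK s_icastK s_DK s_D tensM !s_m.
by rewrite (compK _ (dm_DN _)) compA (compK _ (dm_mD _)) -!tensM !compA.
Qed.

Lemma g_me r A : icast Lo A (esym (mul0n r)) ;; gm G 0 r A ;; ge G (Lo r A) = ge G A.
Proof. by apply: s_epi; rewrite s_icastK s_mK !s_e dm_eN dm_me. Qed.

Lemma g_du A : gd G 0 A ;; gu G A = (ge G A <x> idm A) ;; lu A.
Proof.
by apply: s1_epi; rewrite s_dK s_u dm_du tensMK s_e compf1.
Qed.

Lemma g_dD r q A :
  gd G (r + q).+1 A ;; icast Lo A (idx_D2 r q) ;; gD G r.+1 q.+1 A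
  = (((icast Lo A (esym (addSn r q)) ;; gD G r.+1 q A) <x> idm A) ;; assoc _ _ _
       ;; (idm (Lo r.+1 A) <x> gd G q A))
    <+> (((icast Lo A (esym (addnS r q)) ;; gD G r q.+1 A) <x> idm A) ;; assoc _ _ _
       ;; (idm (Lo r A) <x> sym _ _) ;; associ _ _ _ ;; (gd G r A <x> idm (Lo q.+1 A))).
Proof.
apply: s1_epi; rewrite s_dK s_icastK s_D leibniz_s.
(* Each Leibniz term regains the form with [gd] outside, as the graded law requires. *)
rewrite -(D_ss_l s_d) -(D_ss_r s_d) compDr !tensMK !s_icastK !s_D !comp1f //.
Qed.

Lemma g_dm q t A :
  gd G (q * t + q + t) A ;; icast Lo A (idx_D3a q t) ;; gm G q.+1 t.+1 A
  = (gD G (q * t + q) t A <x> idm A) ;; assoc _ _ _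
    ;; ((icast Lo A (idx_D3b q t) ;; gm G q t.+1 A) <x> gd G t A) ;; gd G q (Lo t.+1 A).
Proof.
apply: s1_epi; rewrite s_dK s_icastK s_m (chain_s s_d).
rewrite [in RHS]tensMK s_D comp1f [(Dl A ;; _) <x> _]tens_factor_l // [in RHS]compA.
by rewrite assocNK tensMK s_icastK s_m -s_d.
Qed.

(** Differentiating at zero and applying [u] returns the direction, weighted by the counit; this
    makes [u] split in [s11_epi]. *)
Lemma d_desc_u A (z : hom (Lo 0 A) !A) : s 0 A ;; z = F (hzero A A) ->
  (z <x> idm A) ;; d A ;; u A = (ge G A <x> idm A) ;; lu A.
Proof.
move=> zE; rewrite dm_du tensMK comp1f; congr ((_ <x> _) ;; _).
by apply: s_epi; rewrite (compK _ zE) dm_eN s_e.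
Qed.

(* With [B = !A (x) A], the object [(Lo n A (x) A) (x) A] is a retract of
   [Lo n B (x) B] via [Lo n p (x) (u (x) 1)], where [p = e (x) 1 : B -> A] up to
   symmetry. [p] itself need not be split, but [Lo n p] is: the coKleisli map
   [f : Lo 1 A -> B] splits [p] up to [gu], and [gm] turns it into the section
   [a]. *)
Lemma s11_epi n A Y (h h' : hom (tens (tens (Lo n A) A) A) Y) :
  ((s n A <x> idm A) <x> idm A) ;; h = ((s n A <x> idm A) <x> idm A) ;; h' -> h = h'.
Proof.
have [z zE] := zero_desc A; set B := tens !A A.
have [p [f fp]] : exists (p : hom B A) (f : hom (Lo 1 A) B), s 1 A ;; f ;; p = u A.
  (* [f] splits the index 1 as 1 + 0: [gu] extracts [A], while [z] turns the part of index 0 into a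
     factor [!A], which [p] discards by [e]. *)
  exists (sym _ _ ;; (idm A <x> e A) ;; ru A), (gD G 1 0 A ;; (gu G A <x> z) ;; sym A !A).
  rewrite !compA (@s_DK 1 0 A) tensMK s_u zE.
  rewrite (compK _ (symK _ _)) comp1f tensMK compf1 dm_eN dm_Dfe //.
have [a ap] : exists a : hom (Lo n A) (Lo n B), a ;; gmap G n p = idm _.
  exists (icast Lo A (esym (muln1 n)) ;; gm G n 1 A ;; gmap G n f).
  apply: s_epi; rewrite !compA s_icastK s_mK s_mapK s_map.
  have -> : F (s 1 A) ;; F f ;; F p ;; s n A = F (u A) ;; s n A.
    by rewrite -fp !bmapM !compA.
  by rewrite -compA dm_mFu comp1f compf1.
(* [c] splits off a spare factor [Lo 0 A]; [z] sends it to [!A], where it is differentiated along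
   the second factor [A] to form [k]. *)
have [c ce] : exists c : hom (Lo n A) (tens (Lo n A) (Lo 0 A)),
    c ;; (idm _ <x> ge G A) ;; ru _ = idm _.
  exists (icast Lo A (esym (addn0 n)) ;; gD G n 0 A).
  by apply: s_epi; rewrite compA s_icastK s_DK tensMK !compf1 s_e dm_Dfe.
have [k kE] : exists k, k ;; (gmap G n p <x> u A) = idm (tens (Lo n A) A).
  exists ((c <x> idm A) ;; assoc _ _ _ ;; (a <x> ((z <x> idm A) ;; d A))).
  rewrite !compA tensM ap compA (d_desc_u zE).
  rewrite -[idm (Lo n A)]comp1f -tensM -assocNK tensMK triangle tensM !compA.
  by rewrite ce !comp1f tens1.
have [K KE] : exists K, K ;; (gmap G n p <x> (u A <x> idm A)) ;; associ _ _ _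
                        = idm (tens (tens (Lo n A) A) A).
  exists ((k <x> idm A) ;; assoc _ _ _).
  by rewrite compA -assocNK tensMK kE assocK comp1f tens1 compf1.
move=> E; suff E' : (gmap G n p <x> (u A <x> idm A)) ;; associ _ _ _ ;; h
                  = (gmap G n p <x> (u A <x> idm A)) ;; associ _ _ _ ;; h'.
  by rewrite -(comp1f h) -(comp1f h') -KE !compA E'.
(* The second hypothesis is used at [B]; naturality of [s] then moves [s] to the other side of
   [gmap G n p], where [E] applies. *)
apply: s1_epi; rewrite !tensMK s_map !comp1f -[u A <x> idm A]compf1 -tensM.
rewrite -tens1 !compA; congr (_ ;; _).
have N Z (g : hom _ Z) := compK g (associN (s n A) (idm A) (idm A)).
by rewrite !N !compA E.
Qed.

Lemma g_dd r A :
  assoc _ _ _ ;; (idm (Lo r A) <x> sym A A) ;; associ _ _ _ ;; (gd G r A <x> idm A) ;; gd G r.+1 A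
  = (gd G r A <x> idm A) ;; gd G r.+1 A.
Proof.
(* Both graded derivatives turn into [d] followed by a single [s r.+2], so [dm_dd] becomes
   applicable. *)
have dd : ((s r A <x> idm A) <x> idm A) ;; (gd G r A <x> idm A) ;; gd G r.+1 A
          = (d A <x> idm A) ;; d A ;; s r.+2 A.
  by rewrite tensMK comp1f -s_d tens_factor_l // compA -s_d.
apply: s11_epi; rewrite dd -[RHS]compA -dm_dd !compA -dd.
have := midN (s r A) (idm A) (idm A) => /compK N.
by have := N _ ((gd G r A <x> idm A) ;; gd G r.+1 A); rewrite !compA.
Qed.

(** * Graded laws assembled, uniqueness and filtration *)

Lemma gmor_gdm : is_gdm G.
Proof.
by do ![split; first by
  [exact: g_map1|exact: g_mapM|exact: g_mN|exact: g_uN|exact: g_DN|exact: g_eN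
  |exact: g_dN|exact: g_mA|exact: g_mFu|exact: g_mu|exact: g_DA|exact: g_De
  |exact: g_Dsym|exact: g_mD|exact: g_me|exact: g_du|exact: g_dD|exact: g_dm]];
  exact: g_dd.
Qed.

(** The morphism equations prescribe each structure map after an epimorphism [s] or [s <x> 1]. *)
Lemma gmor_gdm_same (G' : gdm_data Lo) : is_gmor G' s -> gdm_same G' G.
Proof.
case: HG => [a1 [a2 [a3 [a4 [a5 a6]]]]] [b1 [b2 [b3 [b4 [b5 b6]]]]].
do ![split]; intros; first [apply: s1_epi | apply: s_epi];
  first [by rewrite -a1 -b1 | by rewrite -a2 -b2 | by rewrite a3 b3
        | by rewrite -a4 -b4 | by rewrite a5 b5 | by rewrite -a6 -b6].
Qed.

Lemma fmor_filtered (t : forall n p A, hom (Lo n A) (Lo p A)) :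
  is_fmor s t -> is_filtered G t.
Proof.
move=> tE; have tK n p A Y (g : hom _ Y) (le_pn : p <= n) := compK g (tE n p A le_pn).
split; first by move=> n A; apply: s_epi; rewrite tE // compf1.
split.
  move=> n p q A le_pn le_qp; apply: s_epi.
  by rewrite tK // !tE // (leq_trans le_qp).
split.
  by move=> n p X Y f le_pn; apply: s_epi; rewrite s_mapK tE // tK // s_map.
split.
  move=> r r' q q' A le_r le_q; apply: s_epi.
  by rewrite s_DK tensM !tE // tK ?leq_add // s_D.
split.
  move=> r r' q q' A le_r le_q; apply: s_epi.
  rewrite s_mK s_mapK tE // tK ?leq_mul // s_m.
  by congr (_ ;; _); rewrite -compA -bmapM tE.
move=> r r' A le_r; apply: s1_epi.
by rewrite tensMK tE // comp1f s_dK tE // s_d.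
Qed.

End Laws.

(** * Existence of the structures by choice *)

Lemma gmor_exists : exists G : gdm_data Lo, is_gmor G s.
Proof.
pose cid T (P : T -> Prop) := @constructive_indefinite_description T P.
(* [gd_] is chosen first, because the factorisations giving [gD] and [gm] depend on it. *)
pose gd_ n A := sval (cid _ _ (gd_desc n A)).
have gdE n A : d A ;; s n.+1 A = (s n A <x> idm A) ;; gd_ n A.
  by rewrite (svalP (cid _ _ (gd_desc n A))).
exists (@GDM C Lo
  (fun n X Y f => sval (cid _ _ (gmap_desc n f)))
  (fun n p A => sval (cid _ _ (gm_desc gdE n p A)))
  (fun A => sval (cid _ _ (gu_desc A)))
  (fun n p A => sval (cid _ _ (gD_desc gdE n p A)))
  (fun A => sval (cid _ _ (ge_desc A)))
  gd_).
split; first by move=> n X Y f; rewrite (svalP (cid _ _ (gmap_desc n f))).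
split; first by move=> n p A; rewrite (svalP (cid _ _ (gm_desc gdE n p A))).
split; first by move=> A; exact: (svalP (cid _ _ (gu_desc A))).
split; first by move=> n p A; rewrite (svalP (cid _ _ (gD_desc gdE n p A))).
by split=> // A; exact: (svalP (cid _ _ (ge_desc A))).
Qed.

Lemma fmor_exists (G : gdm_data Lo) : is_gmor G s ->
  exists t : forall n p A, hom (Lo n A) (Lo p A), is_fmor s t.
Proof.
move=> HG; pose t_ex n p A := t_desc (s_d HG) n p A.
exists (fun n p A => sval (constructive_indefinite_description _ (t_ex n p A))).
by move=> n p A; exact: (svalP (constructive_indefinite_description _ (t_ex n p A))).
Qed.

End TaylorFiltration.

Theorem theorem1p1 (C : smc) (HC : is_add_smc C) (M : dm_data C) (HM : is_dm M)
  (Lo : nat -> ob C -> ob C) (s : forall (n : nat) (A : ob C), hom (bang M A) (Lo n A)) :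
  (forall (A : ob C) (n : nat), is_cokernel (dpow M A n.+1) (s n A)) ->
  (forall (A : ob C) (n : nat),
     is_cokernel (dpow M A n.+1 <x> idm A) (s n A <x> idm A)) ->
  exists G : gdm_data Lo,
    (is_gdm G /\ is_gmor G s) /\
    (forall G' : gdm_data Lo, is_gdm G' -> is_gmor G' s -> gdm_same G' G) /\
    (exists t : forall (n p : nat) (A : ob C), hom (Lo n A) (Lo p A),
       (is_filtered G t /\ is_fmor s t) /\
       (forall t' : forall (n p : nat) (A : ob C), hom (Lo n A) (Lo p A),
          is_filtered G t' -> is_fmor s t' ->
          forall (n p : nat) (A : ob C), p <= n -> t' n p A = t n p A)).
Proof.
move=> Hs Hs1; have [G HG] := gmor_exists HC HM Hs Hs1.
have [t tE] := fmor_exists HC Hs HG.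
exists G; split; first by split=> //; exact: (gmor_gdm HC HM Hs Hs1 HG).
split=> [G' _|]; first exact: (gmor_gdm_same HC Hs Hs1 HG).
exists t; split=> [|t' _ t'E n p A le_pn].
  by split=> //; exact: (fmor_filtered HC HM Hs Hs1 HG).
by apply: (s_epi HC Hs); rewrite t'E // tE.
Qed.
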